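(* For integers $u,d,m$ with $1\le m\le\min\{u,d\}$ let $$\mathbf{P}^u_d(m)=\sum_{k=0}^{d-m}\binom{d-m}{k}\prod_{i=0}^{k-1}(m+i+1-r)(i+r)\prod_{j=k+1}^{d-m}(d-m+r-j)(u+r+j),$$ and for nonnegative integers $k$ let $\psi_k(x)=\prod_{i=1}^{k}(x+i)(i-1+2r)$. Then $$\mathbf{P}^u_d(m)\,\psi_{u-m}(m)=\mathbf{P}^d_u(m)\,\psi_{d-m}(m).$$
   Context: $r$ is an indeterminate; the identity is one of polynomials in $r$. *)

(* Defs.v *)
From mathcomp Require Import all_boot all_order all_algebra.

Set Implicit Arguments.
Unset Strict Implicit.
Unset Printing Implicit Defensive.

Import GRing.Theory.
Local Open Scope ring_scope.

(* The indeterminate r is 'X : {poly int}. The subtraction (d - m)%N on nat is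
   truncated, so bigP is only meaningful for m <= d. *)
Definition bigP (u d m : nat) : {poly int} :=
  \sum_(0 <= k < (d - m).+1)
     'C(d - m, k)%:R
     * (\prod_(0 <= i < k) ((m%:R + i%:R + 1 - 'X) * (i%:R + 'X)))
     * (\prod_(k.+1 <= j < (d - m).+1)
          ((d%:R - m%:R + 'X - j%:R) * (u%:R + 'X + j%:R))).

Definition psi (k : nat) (x : {poly int}) : {poly int} :=
  \prod_(1 <= i < k.+1) ((x + i%:R) * (i%:R - 1 + 2%:R * 'X)).

(* Main.v *)
Require Import Defs.
From mathcomp Require Import all_boot all_order all_algebra.
From mathcomp Require Import ring zify.

Set Implicit Arguments.
Unset Strict Implicit.
Unset Printing Implicit Defensive.

Import GRing.Theory.
Local Open Scope ring_scope.

(** Write [n = d - m], [p = u - m] and [(x)_k] for rising factorials. Expanding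
    the factor [(m + 1 + p + r + k)_(n-k)] of [P^u_d(m)] in falling factorials
    [p^_j] (Vandermonde) and summing over [k] with the Pfaff-Saalschutz identity
    gives
      [P^u_d(m) = \sum_j C(n,j) p^_j (r)_j (2r+j)_(n-j) (m+1+j)_(n-j)].
    Here [C(n,j) p^_j = j! C(n,j) C(p,j)] is symmetric in [n] and [p], and
    multiplying by [psi_p(m) = (m+1)_p (2r)_p] makes the other factors symmetric
    as well. *)

Section RisingFactorial.
Variable R : comPzRingType.
Implicit Types (x a b c : R) (f : nat -> R) (g : nat -> nat -> R).

Definition rising x n : R := \prod_(i < n) (x + i%:R).

Lemma rising0 x : rising x 0 = 1.
Proof. by rewrite /rising big_ord0. Qed.

Lemma risingSr x n : rising x n.+1 = rising x n * (x + n%:R).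
Proof. by rewrite /rising big_ord_recr. Qed.

Lemma risingD x m n : rising x (m + n) = rising x m * rising (x + m%:R) n.
Proof.
elim: n => [|n IHn]; first by rewrite addn0 rising0 mulr1.
by rewrite addnS !risingSr IHn natrD addrA mulrA.
Qed.

Lemma risingS x n : rising x n.+1 = x * rising (x + 1) n.
Proof. by rewrite -add1n risingD risingSr rising0 mul1r addr0. Qed.

Lemma rising_diff x n :
  rising (x + 1) n.+1 = rising x n.+1 + n.+1%:R * rising (x + 1) n.
Proof. by rewrite risingSr risingS -natr1; ring. Qed.

(** Pascal's rule, with the half carrying ['C(n, k - 1)] reindexed. This is the induction step for
    the two summation formulas below. *)
Lemma sum_binS n f :
  \sum_(k < n.+2) 'C(n.+1, k)%:R * f k =
  \sum_(k < n.+1) 'C(n, k)%:R * (f k + f k.+1).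
Proof.
rewrite big_ord_recl /= bin0.
under eq_bigr => k _ do rewrite /bump /= add1n binS natrD mulrDl.
rewrite big_split /= [X in _ + (X + _)]big_ord_recr /= bin_small // mul0r addr0.
rewrite addrA -(bin0 n); under [RHS]eq_bigr do rewrite mulrDr.
by rewrite big_split /= [X in _ = X + _]big_ord_recl.
Qed.

Lemma sum_bin_widen n N f : (n <= N)%N ->
  \sum_(k < n.+1) 'C(n, k)%:R * f k = \sum_(k < N.+1) 'C(n, k)%:R * f k.
Proof.
move=> le_nN.
rewrite (big_ord_widen N.+1 (fun k => 'C(n, k)%:R * f k)) // big_mkcond /=.
by apply: eq_bigr => k _; case: ltnP => // lt_nk; rewrite bin_small // mul0r.
Qed.

(** Both sides are the trinomial coefficient n!/(j! k! (n-j-k)!), or 0 when [j + k > n]. *)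
Lemma mul_bin_subC n j k : ('C(n, k) * 'C(n - k, j) = 'C(n, j) * 'C(n - j, k))%N.
Proof.
have [le_jkn | lt_njk] := leqP (j + k) n; last first.
  have [le_kn | lt_nk] := leqP k n; last first.
    by rewrite (bin_small lt_nk) (@bin_small (n - j) k) ?muln0 //; lia.
  rewrite [X in (_ * X)%N]bin_small; last by lia.
  rewrite muln0; have [le_jn | /bin_small-> //] := leqP j n.
  by rewrite (@bin_small (n - j) k) ?muln0 //; lia.
have := bin_fact (n := n) (m := k) ltac:(lia).
have := bin_fact (n := n) (m := j) ltac:(lia).
have := bin_fact (n := n - k) (m := j) ltac:(lia).
have := bin_fact (n := n - j) (m := k) ltac:(lia).
rewrite -!subnDA (addnC k j) => <- <- En; rewrite -{}En => En.
apply/eqP; rewrite -(@eqn_pmul2r (j`! * k`! * (n - (j + k))`!)); last first.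
  by rewrite !muln_gt0 !fact_gt0.
apply/eqP; lia.
Qed.

Lemma sum_bin_exchange n g :
  \sum_(k < n.+1) 'C(n, k)%:R * \sum_(j < (n - k).+1) 'C(n - k, j)%:R * g j k =
  \sum_(j < n.+1) 'C(n, j)%:R * \sum_(k < (n - j).+1) 'C(n - j, k)%:R * g j k.
Proof.
under eq_bigr => k _ do
  rewrite (@sum_bin_widen (n - k) n (g^~ k)) ?leq_subr // mulr_sumr.
under [RHS]eq_bigr => j _ do
  rewrite (@sum_bin_widen (n - j) n (g j)) ?leq_subr // mulr_sumr.
rewrite exchange_big /=; apply: eq_bigr => j _; apply: eq_bigr => k _.
by rewrite !mulrA -!natrM mul_bin_subC.
Qed.

(** The subtraction on the right is not truncated; for [p < j] the factor [p ^_ j] is already 0. *)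
Lemma natr_ffactS p j : (p ^_ j.+1)%:R = (p ^_ j)%:R * (p%:R - j%:R) :> R.
Proof.
rewrite ffactnSr natrM; have [le_jp | lt_pj] := leqP j p; first by rewrite natrB.
by rewrite ffact_small // !mul0r.
Qed.

(** Pascal's rule merges terms j and j+1, whose leading factors add up to (c+j) + (p-j) = c+p; what
    remains is the formula for [n] at [c + 1]. *)
Lemma rising_Vandermonde c p n :
  rising (c + p%:R) n =
  \sum_(j < n.+1) 'C(n, j)%:R * ((p ^_ j)%:R * rising (c + j%:R) (n - j)).
Proof.
elim: n c => [|n IHn] c.
  by rewrite big_ord_recr big_ord0 /= !rising0 bin0 ffactn0; ring.
rewrite (sum_binS n (fun j => (p ^_ j)%:R * rising (c + j%:R) (n.+1 - j))).
rewrite risingS -addrA (addrC p%:R) addrA IHn mulr_sumr.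
apply: eq_bigr => j _; have le_jn := ltn_ord j.
rewrite subSn // subSS risingS natr_ffactS -natr1.
have ->: c + (j%:R + 1) = c + j%:R + 1 by ring.
have ->: c + 1 + j%:R = c + j%:R + 1 by ring.
ring.
Qed.

(** The balanced series 3F2(a, b, -n; a+b+c, 1-c-n; 1) multiplied by (c)_n (a+b+c)_n, which clears
    all denominators. *)
Definition Saalschutz_sum a b c n : R :=
  \sum_(k < n.+1) 'C(n, k)%:R *
    (rising a k * rising b k * rising c (n - k)
     * rising (a + b + c + k%:R) (n - k)).

(* Pascal's rule combines consecutive terms; with [N = n.+1], the
   weight [(c+N-k)(a+b+c+k) + (a+k)(b+k)] equals [(a+c+N)(b+c+N) - N(c+N-k)]. *)
Lemma Saalschutz_sumSS a b c n :
  Saalschutz_sum a b c n.+2 =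
  (a + c + n.+1%:R) * (b + c + n.+1%:R)
    * (Saalschutz_sum a b c n.+1 + n.+1%:R * c * Saalschutz_sum a b (c + 1) n)
  - n.+1%:R * c * Saalschutz_sum a b (c + 1) n.+1.
Proof.
set W := (a + c + _) * _.
pose s : R := a + b + c.
pose t k : R := rising a k * rising b k * rising c (n.+1 - k)
  * rising (s + k%:R + 1) (n.+1 - k).
have shift_c k : a + b + (c + 1) + k%:R = s + k%:R + 1 by rewrite /s; ring.
(* [rising_diff] splits the last factor of [t k], and (n+1-k) C(n+1,k) = (n+1) C(n,k) turns the
   second piece into the sum at [c + 1]. *)
have sum_t : Saalschutz_sum a b c n.+1
    + n.+1%:R * c * Saalschutz_sum a b (c + 1) n
    = \sum_(k < n.+2) 'C(n.+1, k)%:R * t k.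
  rewrite /Saalschutz_sum big_ord_recr [RHS]big_ord_recr /= addrAC.
  rewrite mulr_sumr -big_split /= /t !subnn !rising0; congr (_ + _).
  apply: eq_bigr => k _; have le_kn := ltn_ord k.
  have binE : n.+1%:R * 'C(n, k)%:R = 'C(n.+1, k)%:R * (n - k).+1%:R :> R.
    by rewrite -!natrM mul_bin_down subSn // mulnC.
  rewrite subSn // rising_diff shift_c [rising c _]risingS -/s.
  rewrite [X in _ + X]mulrACA binE; ring.
rewrite sum_t /Saalschutz_sum.
rewrite (sum_binS n.+1 (fun k => rising a k * rising b k * rising c (n.+2 - k)
  * rising (s + k%:R) (n.+2 - k))).
rewrite !mulr_sumr -sumrB; apply: eq_bigr => k _; have le_kn := ltn_ord k.
have natE : n.+1%:R = (n.+1 - k)%:R + k%:R :> R by rewrite -natrD subnK.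
rewrite shift_c subSn // subSS [rising (s + k%:R) _]risingS !(risingSr _ k).
have -> : s + k.+1%:R = s + k%:R + 1 by rewrite -natr1 addrA.
have cE : c * rising (c + 1) (n.+1 - k) =
    rising c (n.+1 - k) * (c + (n.+1 - k)%:R).
  by rewrite -risingS risingSr.
rewrite [n.+1%:R * c]mulrC.
have -> : c * n.+1%:R * ('C(n.+1, k)%:R * (rising a k * rising b k
    * rising (c + 1) (n.+1 - k) * rising (s + k%:R + 1) (n.+1 - k)))
  = n.+1%:R * 'C(n.+1, k)%:R * (c * rising (c + 1) (n.+1 - k))
    * (rising a k * rising b k * rising (s + k%:R + 1) (n.+1 - k)) by ring.
rewrite cE risingSr /W /t natE.
move: (rising (s + _ + 1) _) (rising c _) (rising a k) (rising b k) => *.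
rewrite /s; ring.
Qed.

(** The product satisfies the same recurrence. That recurrence goes back two steps and shifts [c],
    hence two base cases and an induction with [c] general. *)
Lemma Pfaff_Saalschutz a b c n :
  Saalschutz_sum a b c n = rising (a + c) n * rising (b + c) n.
Proof.
have [k] := ubnP n; elim: k n c => // k IHk [|[|n]] c lt_nk.
- by rewrite /Saalschutz_sum big_ord_recr big_ord0 /= !rising0 bin0; ring.
- rewrite /Saalschutz_sum !big_ord_recr big_ord0 /= !risingSr !rising0 binn bin0.
  ring.
rewrite Saalschutz_sumSS !IHk; try lia.
rewrite !addrA [rising (a + c) n.+2]risingSr [rising (b + c) n.+2]risingSr.
rewrite [rising (a + c + 1) n.+1]risingSr [rising (b + c + 1) n.+1]risingSr.
by rewrite -natr1; ring.
Qed.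

End RisingFactorial.

Section SymmetricForm.
Variable R : comPzRingType.
Implicit Types x r : R.

Lemma sum_rising_symmetric_form x r n p :
  \sum_(k < n.+1) 'C(n, k)%:R *
    (rising (x - r) k * rising r k * rising r (n - k)
     * rising (x + r + k%:R + p%:R) (n - k)) =
  \sum_(j < n.+1) 'C(n, j)%:R * ((p ^_ j)%:R * rising r j
     * rising (2%:R * r + j%:R) (n - j) * rising (x + j%:R) (n - j)).
Proof.
pose g j k : R := rising (x - r) k * rising r k * rising r (n - k)
  * ((p ^_ j)%:R * rising (x + r + k%:R + j%:R) (n - k - j)).
transitivity (\sum_(k < n.+1) 'C(n, k)%:R *
    \sum_(j < (n - k).+1) 'C(n - k, j)%:R * g j k).
  apply: eq_bigr => k _; rewrite rising_Vandermonde mulr_sumr; congr (_ * _).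
  by apply: eq_bigr => j _; rewrite mulrCA.
rewrite sum_bin_exchange; apply: eq_bigr => j _; congr (_ * _).
(* Pfaff-Saalschutz is applied with a = x-r, b = r, c = r+j. *)
have ->: 2%:R * r + j%:R = r + (r + j%:R) by ring.
have ->: x + j%:R = x - r + (r + j%:R) by ring.
rewrite -!mulrA [X in _ * (_ * X)]mulrC -Pfaff_Saalschutz !mulrA mulr_sumr.
apply: eq_bigr => k _; rewrite /g.
have le_jn := ltn_ord j; have le_kn := ltn_ord k.
(* (r)_(n-k) = (r)_j (r+j)_(n-j-k): the first factor does not depend on [k], the second is the one
   built on c. *)
have -> : (n - k = j + (n - j - k))%N by lia.
rewrite addKn risingD.
have ->: x + r + k%:R + j%:R = x - r + r + (r + j%:R) + k%:R by ring.
ring.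
Qed.

End SymmetricForm.

Lemma bigP_sum_rising u d m : (m <= minn u d)%N ->
  bigP u d m = \sum_(k < (d - m).+1) 'C(d - m, k)%:R *
    (rising (m.+1%:R - 'X) k * rising 'X k * rising 'X (d - m - k)
     * rising (m.+1%:R + 'X + k%:R + (u - m)%:R) (d - m - k)).
Proof.
rewrite leq_min => /andP[le_mu le_md].
rewrite /bigP -natrB // big_mkord; apply: eq_bigr => k _.
have le_kn := ltn_ord k; set n := (d - m)%N in k le_kn *.
rewrite -!mulrA; congr (_ * _); rewrite !big_split /= mulrA; congr (_ * _ * _).
- by rewrite big_mkord; apply: eq_bigr => i _; rewrite -natr1; ring.
- by rewrite big_mkord; apply: eq_bigr => i _; rewrite addrC.
congr (_ * _).
(* Reversing the product makes the factors d-m+r-j ascend from r. *)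
- rewrite big_nat_rev /= -{1}[k.+1]add0n big_addn big_mkord subSS.
  apply: eq_bigr => i _; have lt_i := ltn_ord i.
  by rewrite -addrA addrCA -natrB ?addrA; [congr (_ + _%:R); lia | lia].
- rewrite -{1}[k.+1]add0n big_addn big_mkord subSS.
  apply: eq_bigr => i _; rewrite -{1}(subnK le_mu) addnS -!natr1 !natrD; ring.
Qed.

Lemma psiE k x : psi k x = rising (x + 1) k * rising (2%:R * 'X) k.
Proof.
rewrite /psi big_split /= !big_add1 !big_mkord; congr (_ * _).
- by apply: eq_bigr => i _; rewrite -natr1 -addrA [1 + _]addrC.
- by apply: eq_bigr => i _; rewrite -natr1 addrK addrC.
Qed.

Theorem theorem5p7 (u d m : nat) (hm1 : (1 <= m)%N) (hm2 : (m <= minn u d)%N) :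
  bigP u d m * psi (u - m) m%:R = bigP d u m * psi (d - m) m%:R.
Proof.
rewrite !bigP_sum_rising //; last by rewrite minnC.
rewrite !sum_rising_symmetric_form !psiE natr1.
set n := (d - m)%N; set p := (u - m)%N; set x := m.+1%:R; set y := 2%:R * 'X.
pose f n p j : {poly int} :=
  (p ^_ j)%:R * rising 'X j * rising (y + j%:R) (n - j) * rising (x + j%:R) (n - j).
(* A common range lets the two sums be compared term by term; the added terms vanish. *)
rewrite (@sum_bin_widen _ n (n + p) (f n p)) ?leq_addr //.
rewrite (@sum_bin_widen _ p (n + p) (f p n)) ?leq_addl //.
rewrite !mulr_suml; apply: eq_bigr => j _; rewrite /f !mulrA -!natrM.
have -> : ('C(n, j) * p ^_ j = 'C(p, j) * n ^_ j)%N.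
  by rewrite -!bin_ffact mulnCA.
have [le_jn|lt_nj] := leqP j n; last by rewrite ffact_small // muln0 !mul0r.
have [le_jp|lt_pj] := leqP j p; last by rewrite bin_small // mul0n !mul0r.
(* For [j] at most [n] and [p], cutting the factors of [psi] at [j] leaves on both sides (x)_j (y)_j
   and the same four tails. *)
have split z k : (j <= k)%N ->
  rising z k = rising z j * rising (z + j%:R) (k - j) :> {poly int}.
  by move=> le_jk; rewrite -risingD subnKC.
rewrite (split x p) // (split x n) // (split y p) // (split y n) //; ring.
Qed.
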